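(* Let $A$ be an $\ell$-controllable complete group system. The generator group $(\mathcal{U},\circ)$ of $A$ gives a collection of upper elementary groups $(\nabla_{0,k}^t(\mathcal{U}),\circledcirc_{0,k}^t)$, for each $t\in\mathbf{Z}$ and $0\le k\le\ell$, which have the nested homomorphism property: whenever $t,t'\in\mathbf{Z}$ and $0\le k,k'\le\ell$ are such that the index triangle $T_{k'}^{t'}$ is contained in $T_k^t$, the projection $\nabla_{0,k}^t(\mathcal{U})\to\nabla_{0,k'}^{t'}(\mathcal{U})$, $\nabla_{0,k}^t(\mathbf{u})\mapsto\nabla_{0,k'}^{t'}(\mathbf{u})$, is a homomorphism from $(\nabla_{0,k}^t(\mathcal{U}),\circledcirc_{0,k}^t)$ to $(\nabla_{0,k'}^{t'}(\mathcal{U}),\circledcirc_{0,k'}^{t'})$.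
   Context: Let $(A^t)_{t\in\mathbf{Z}}$ be finite groups. A group system $A$ is a set of sequences $\mathbf{a}=(a^t)_{t\in\mathbf{Z}}$, $a^t\in A^t$, forming a group under componentwise operation, such that every element of $A^t$ occurs as a time-$t$ component, for each $t$. $\chi^t:A\to A^t$ is $\mathbf{a}\mapsto a^t$. $A$ is $\ell$-controllable ($\ell>0$) if for every $t\in\mathbf{Z}$ and all $\dot{\mathbf{a}},\ddot{\mathbf{a}}\in A$ there is $\mathbf{a}\in A$ agreeing with $\dot{\mathbf{a}}$ at all times $<t$ and with $\ddot{\mathbf{a}}$ at all times $\ge t+\ell$. $A$ is complete if every sequence in $\prod_t A^t$ whose restriction to each finite interval is the restriction of some element of $A$ belongs to $A$. $A^{[m,n]}$ is the set of sequences in $A$ that are the identity outside $[m,n]$. $X^t$ (resp. $Y^t$) is the normal subgroup of sequences in $A$ that are the identity at all times $<t$ (resp. $>t$). Basis: for $t\in\mathbf{Z}$, $0\le k\le\ell$ put $\Lambda^{[t,t+k]}=X^{t+1}(X^t\cap Y^{t+k})/X^{t+1}(X^t\cap Y^{t+k-1})$. A basis is a choice, for each $(k,t)$, of a transversal $[\Lambda^{[t,t+k]}]$ whose elements (generators $\mathbf{g}^{[t,t+k]}$) lie in $A^{[t,t+k]}$ and in which the trivial coset is represented by the identity sequence. $\mathcal{R}=\prod_{t\in\mathbf{Z}}\prod_{0\le k\le\ell}[\Lambda^{[t,t+k]}]$. The map $\alpha:\mathcal{R}\to A$ sends $\mathbf{r}=(\mathbf{g}^{[t,t+k]})_{k,t}$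 to $\prod_{i=+\infty}^{-\infty}\prod_{m=0}^{\ell}\mathbf{g}^{[i,i+m]}$, i.e. the sequence with time-$t$ component $\prod_{j=0}^{\ell}\bigl(\prod_{k=j}^{\ell}\chi^t(\mathbf{g}^{[t-j,t-j+k]})\bigr)$ (factors written left to right in increasing $j$, and increasing $k$ for each $j$); $\alpha$ is a bijection. The operation $*$ on $\mathcal{R}$ is $\dot{\mathbf{r}}*\ddot{\mathbf{r}}=\alpha^{-1}(\alpha(\dot{\mathbf{r}})\alpha(\ddot{\mathbf{r}}))$. For each $(k,t)$ let $G_k^t$ be a set of labels with a fixed bijection $[\Lambda^{[t,t+k]}]\to G_k^t$, $\mathbf{g}^{[t,t+k]}\mapsto g_k^t$. $\mathcal{U}=\prod_{t\in\mathbf{Z}}\prod_{0\le k\le\ell}G_k^t$, and $\beta:\mathcal{R}\to\mathcal{U}$ replaces each generator by its label. The operation $\circ$ on $\mathcal{U}$ is $\beta(\dot{\mathbf{r}})\circ\beta(\ddot{\mathbf{r}})=\beta(\dot{\mathbf{r}}*\ddot{\mathbf{r}})$; $(\mathcal{U},\circ)$ is the generator group. Upper triangles: for $t\in\mathbf{Z}$, $0\le k\le\ell$ let $T_k^t=\{(m,t-j):0\le j\le\ell-k,\ k+j\le m\le\ell\}$ (triangle with lower vertex $(k,t)$ and upper vertices $(\ell,t)$, $(\ell,t-(\ell-k))$). For $\mathbf{u}=(g_m^s)\in\mathcal{U}$, $\nabla_{0,k}^t(\mathbf{u})=(g_m^s)_{(m,s)\in T_k^t}$, and $\nabla_{0,k}^t(\mathcal{U})=\{\nabla_{0,k}^t(\mathbf{u}):\mathbf{u}\in\mathcal{U}\}$.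 The upper elementary group $(\nabla_{0,k}^t(\mathcal{U}),\circledcirc_{0,k}^t)$ has the (well-defined) operation $\nabla_{0,k}^t(\dot{\mathbf{u}})\circledcirc_{0,k}^t\nabla_{0,k}^t(\ddot{\mathbf{u}})=\nabla_{0,k}^t(\dot{\mathbf{u}}\circ\ddot{\mathbf{u}})$. *)

(* Defs.v *)
From HB Require Import structures.
From mathcomp Require Import all_boot all_order all_algebra all_fingroup.
From mathcomp Require Import boolp classical_sets functions.
Set Implicit Arguments.
Unset Strict Implicit.
Unset Printing Implicit Defensive.
Import Order.TTheory GRing.Theory Num.Theory.
Local Open Scope classical_set_scope.
Local Open Scope ring_scope.

Definition gseq (A : int -> finGroupType) : Type := forall t : int, A t.

Section SequenceGroup.
Variable A : int -> finGroupType.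
Implicit Types a b c : gseq A.

Definition gseq_one : gseq A := fun t => 1%g.
Definition gseq_inv a : gseq A := fun t => (a t)^-1%g.
Definition gseq_mul a b : gseq A := fun t => (a t * b t)%g.

Fact gseq_mulA : associative gseq_mul.
Proof. by move=> a b c; apply: functional_extensionality_dep => t; apply: mulgA. Qed.
Fact gseq_mul1 : left_id gseq_one gseq_mul.
Proof. by move=> a; apply: functional_extensionality_dep => t; apply: mul1g. Qed.
Fact gseq_mulr1 : right_id gseq_one gseq_mul.
Proof. by move=> a; apply: functional_extensionality_dep => t; apply: mulg1. Qed.
Fact gseq_mulV : left_inverse gseq_one gseq_inv gseq_mul.
Proof. by move=> a; apply: functional_extensionality_dep => t; apply: mulVg. Qed.
Fact gseq_mulVr : right_inverse gseq_one gseq_inv gseq_mul.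
Proof. by move=> a; apply: functional_extensionality_dep => t; apply: mulgV. Qed.

HB.instance Definition _ := gen_eqMixin (gseq A).
HB.instance Definition _ := gen_choiceMixin (gseq A).
HB.instance Definition _ := isGroup.Build (gseq A)
  gseq_mulA gseq_mul1 gseq_mulr1 gseq_mulV gseq_mulVr.

End SequenceGroup.

Section GroupSystem.
Variables (A : int -> finGroupType) (S : set (gseq A)).

Definition group_system : Prop :=
  group_closed (mem S) /\ forall (t : int) (x : A t), exists2 a, S a & a t = x.

Definition controllable (l : nat) : Prop :=
  forall (t : int) (a1 a2 : gseq A), S a1 -> S a2 ->
    exists a, [/\ S a,
      forall i : int, i < t -> a i = a1 i &
      forall i : int, t + l%:Z <= i -> a i = a2 i].

Definition complete_system : Prop :=
  forall x : gseq A,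
    (forall m n : int, exists2 a, S a & forall i : int, m <= i <= n -> a i = x i) ->
    S x.

Definition seqs_on (m n : int) : set (gseq A) :=
  [set a | S a /\ forall i : int, ~~ (m <= i <= n) -> a i = 1%g].

Definition Xsub (t : int) : set (gseq A) :=
  [set a | S a /\ forall i : int, i < t -> a i = 1%g].

Definition Ysub (t : int) : set (gseq A) :=
  [set a | S a /\ forall i : int, t < i -> a i = 1%g].

(* X^{t+1} (X^t `&` Y^n) *)
Definition shell (t n : int) : set (gseq A) :=
  [set (x * y)%g | x in Xsub (t + 1) & y in Xsub t `&` Ysub n].

(* Left cosets; the denominator is normal, so right cosets are the same. *)
Definition Lambda (t : int) (k : nat) : set (set (gseq A)) :=
  [set [set (a * d)%g | d in shell t (t + k%:Z - 1)] | a in shell t (t + k%:Z)].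

End GroupSystem.

Definition transversal_of (T : Type) (P : set (set T)) (V : set T) : Prop :=
  V `<=` \bigcup_(C in P) C /\ forall C, P C -> exists! g, V g /\ C g.

(* Throughout, [B t k] is the transversal [Lambda^{[t,t+k]}]; a family of       *)
(* generators is written r with r t k = g^{[t,t+k]}.                            *)
Definition is_basis (A : int -> finGroupType) (S : set (gseq A)) (l : nat)
    (B : int -> 'I_l.+1 -> set (gseq A)) : Prop :=
  forall (t : int) (k : 'I_l.+1),
    [/\ transversal_of (Lambda S t k) (B t k),
        B t k `<=` seqs_on S t (t + k%:Z) &
        B t k 1%g].

Section GeneratorGroup.
Variables (A : int -> finGroupType) (l : nat).
Variable B : int -> 'I_l.+1 -> set (gseq A).
Variable G : int -> 'I_l.+1 -> Type.
Variable lab : forall (t : int) (k : 'I_l.+1), gseq A -> G t k.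

Definition genfam : Type := int -> 'I_l.+1 -> gseq A.

Definition Rset : set genfam :=
  [set r | forall (t : int) (k : 'I_l.+1), B t k (r t k)].

(* Bigops over ordinals multiply in increasing index order, left to right. *)
Definition alpha (r : genfam) : gseq A := fun t =>
  (\prod_(j < l.+1) \prod_(k < l.+1 | (j <= k)%N) r (t - j%:Z) k t)%g.

(* ['pinv_d R f] is the inverse of the restriction of f to R, with junk value   *)
(* d outside f @` R. *)
Definition alpha_inv : gseq A -> genfam :=
  'pinv_(fun=> (fun _ _ => 1%g)) Rset alpha.

Definition star (r1 r2 : genfam) : genfam :=
  alpha_inv (alpha r1 * alpha r2)%g.

Definition labfam : Type := forall (t : int) (k : 'I_l.+1), G t k.

Definition beta (r : genfam) : labfam := fun t k => lab t k (r t k).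

Definition beta_inv : labfam -> genfam :=
  'pinv_(fun=> (fun _ _ => 1%g)) Rset beta.

Definition circ (u1 u2 : labfam) : labfam :=
  beta (star (beta_inv u1) (beta_inv u2)).

End GeneratorGroup.

Section UpperTriangles.
Variable l : nat.
Variable G : int -> 'I_l.+1 -> Type.

(* The index (m, s) stands for the label g_m^s. *)
Definition triangle (t : int) (k : 'I_l.+1) : set ('I_l.+1 * int) :=
  [set p : 'I_l.+1 * int | exists j : nat,
    [/\ (j <= l - k)%N, (k + j <= p.1 <= l)%N & p.2 = t - j%:Z :> int]].

Definition trifam (T : set ('I_l.+1 * int)) : Type :=
  forall p : 'I_l.+1 * int, T p -> G p.2 p.1.

Definition nabla (t : int) (k : 'I_l.+1) (u : labfam G) : trifam (triangle t k) :=
  fun p _ => u p.2 p.1.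

Arguments nabla : clear implicits.

Definition tri_proj (T T' : set ('I_l.+1 * int)) (sT : T' `<=` T)
    (x : trifam T) : trifam T' :=
  fun p Tp => x p (sT p Tp).

(* nabla_{0,k}^t(U) *)
Definition nablaU (t : int) (k : 'I_l.+1) : set (trifam (triangle t k)) :=
  range (nabla t k).

End UpperTriangles.

Arguments nabla {l G} t k u.
Arguments nablaU {l} G t k _.

Definition group_on (T : Type) (D : set T) (op : T -> T -> T) : Prop :=
  [/\ forall x y, D x -> D y -> D (op x y),
      forall x y z, D x -> D y -> D z -> op x (op y z) = op (op x y) z &
      exists2 e, D e &
        (forall x, D x -> op e x = x /\ op x e = x) /\
        (forall x, D x -> exists2 y, D y & op y x = e /\ op x y = e)].

(* [op] is the operation induced on nabla_{0,k}^t(U) by [mul]; existence of such *)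
(* an op is the well-definedness of the induced operation, and its values on     *)
(* nabla_{0,k}^t(U) are then unique.                                             *)
Definition upper_elementary_group (l : nat) (G : int -> 'I_l.+1 -> Type)
    (mul : labfam G -> labfam G -> labfam G) (t : int) (k : 'I_l.+1)
    (op : trifam G (triangle t k) -> trifam G (triangle t k) ->
          trifam G (triangle t k)) : Prop :=
  (forall u1 u2 : labfam G,
     op (nabla t k u1) (nabla t k u2) = nabla t k (mul u1 u2)) /\
  group_on (nablaU G t k) op.

(* Main.v *)
(** Put N(t,k) = X^{t+1} Y^{t+k-1}, a normal subgroup of A.  In the product
    alpha(r) the generators starting after t lie in X^{t+1} and those ending
    before t+k lie in Y^{t+k-1}; what remains modulo N(t,k) is exactly the
    triangle T_k^t, the generators whose span contains [t,t+k].  Conversely the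
    class of alpha(r) modulo N(t,k) determines the triangle, by induction on
    l-k: it determines the triangles T_{k+1}^t and T_{k+1}^{t-1}, and g_k^t is
    then the leftmost surviving factor of alpha(r).  Hence nabla_{0,k}^t
    identifies nabla_{0,k}^t(U) with the quotient group A / N(t,k), and the
    projections between triangles are the canonical maps between quotients.

    Surjectivity of alpha is obtained by choosing the generators by decreasing
    k, starting from N(t,l+1) = A, which is l-controllability, and using
    N(t,k+1) `&` N(t-1,k+1) = N(t,k) (X^t `&` Y^{t+k}); N(t,0) consists of
    sequences that are trivial at time t. *)

Require Import Defs.
From HB Require Import structures.
From mathcomp Require Import all_boot all_order all_algebra all_fingroup.
From mathcomp Require Import boolp classical_sets functions.
From mathcomp Require Import zify.
Set Implicit Arguments.
Unset Strict Implicit.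
Unset Printing Implicit Defensive.
Import Order.TTheory GRing.Theory Num.Theory.
Local Open Scope classical_set_scope.
Local Open Scope ring_scope.

(** * Subgroups normal relative to [S], and congruence modulo them *)

Record normal_sub {gT : groupType} (S N : set gT) : Prop := NormalSub {
  nsub_sub : N `<=` S;
  nsub1 : N 1%g;
  nsubM : forall x y, N x -> N y -> N (x * y)%g;
  nsubV : forall x, N x -> N x^-1%g;
  nsubJ : forall x s, N x -> S s -> N (s * x * s^-1)%g }.

Definition cong {gT : groupType} (N : set gT) (a b : gT) : Prop := N (a * b^-1)%g.

Definition prodset {gT : groupType} (M N : set gT) : set gT :=
  [set (x * y)%g | x in M & y in N].

Section NormalSub.
Context {gT : groupType} (S : set gT).
Hypothesis S_group : normal_sub S S.
Implicit Types M N : set gT.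

Lemma normal_prodset M N :
  normal_sub S M -> normal_sub S N -> normal_sub S (prodset M N).
Proof.
move=> nM nN; split.
- move=> _ [x Mx [y Ny <-]].
  by apply: (nsubM S_group); [apply: (nsub_sub nM)|apply: (nsub_sub nN)].
- by exists 1%g; [apply: (nsub1 nM)|exists 1%g; [apply: (nsub1 nN)|rewrite mulg1]].
- move=> _ _ [x Mx [y Ny <-]] [x' Mx' [y' Ny' <-]].
  exists (x * (y * x' * y^-1))%g.
    apply: (nsubM nM) => //; apply: (nsubJ nM) => //.
    exact: (nsub_sub nN).
  by exists (y * y')%g; [apply: (nsubM nN)|rewrite !mulgA mulgKV].
- move=> _ [x Mx [y Ny <-]].
  exists (y^-1 * x^-1 * y^-1^-1)%g.
    apply: (nsubJ nM); first exact: (nsubV nM).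
    by apply: (nsub_sub nN); apply: (nsubV nN).
  exists y^-1%g; first exact: (nsubV nN).
  by rewrite invgK mulgK invgM.
- move=> _ s [x Mx [y Ny <-]] Ss.
  exists (s * x * s^-1)%g; first exact: (nsubJ nM).
  exists (s * y * s^-1)%g; first exact: (nsubJ nN).
  by rewrite !mulgA mulgKV.
Qed.

Variable N : set gT.
Hypothesis nN : normal_sub S N.

Lemma cong_refl a : cong N a a.
Proof. by rewrite /cong mulgV; apply: nsub1 nN. Qed.

Lemma cong_sym a b : cong N a b -> cong N b a.
Proof. by move=> /(nsubV nN); rewrite invgM invgK. Qed.

Lemma cong_trans b a c : cong N a b -> cong N b c -> cong N a c.
Proof. by move=> /(nsubM nN) /[apply]; rewrite mulgA mulgKV. Qed.

(** The quotient is [c * d^-1] conjugated by [a], times [a * b^-1]; only [a] has to lie in [S]. *)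
Lemma cong_mul a b c d : S a -> cong N a b -> cong N c d -> cong N (a * c) (b * d).
Proof.
move=> Sa ab /(nsubJ nN) /(_ Sa) cd.
by have := nsubM nN cd ab; rewrite /cong invgM !mulgA mulgKV.
Qed.

Lemma cong_cancel a b c d : S b -> cong N (a * c) (b * d) -> cong N c d -> cong N a b.
Proof.
move=> Sb acbd /cong_sym dc; have := cong_trans acbd (cong_mul Sb (cong_refl b) dc).
by rewrite /cong invgM mulgA mulgK.
Qed.

Lemma cong1 a : N a -> cong N a 1%g.
Proof. by rewrite /cong invg1 mulg1. Qed.

Lemma prod_mem n (f : 'I_n -> gT) : (forall i, N (f i)) -> N (\prod_(i < n) f i)%g.
Proof.
move=> Nf; apply: (big_ind N) => //; [exact: nsub1 nN|exact: nsubM nN].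
Qed.

Lemma prod_cong n (f g : 'I_n -> gT) : (forall i, S (f i)) ->
  (forall i, cong N (f i) (g i)) ->
  cong N (\prod_(i < n) f i)%g (\prod_(i < n) g i)%g.
Proof.
move=> Sf fg.
suff [] : cong N (\prod_(i < n) f i)%g (\prod_(i < n) g i)%g /\
  S (\prod_(i < n) f i)%g by [].
apply: (big_rec2 (fun a b => cong N a b /\ S a)) => [|i y1 y2 _ [c s]].
  by split; [apply: cong_refl|apply: nsub1 S_group].
by split; [apply: cong_mul|apply: (nsubM S_group)].
Qed.

(* The factors before position k die modulo N, so f k becomes the leftmost one. *)
Lemma prod_cong_pivot n (f g : 'I_n -> gT) (k : 'I_n) : (forall i, S (f i)) ->
  (forall i : 'I_n, (i < k)%N -> N (f i) /\ N (g i)) -> g k = 1%g ->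
  (forall i : 'I_n, (k < i)%N -> f i = g i) ->
  cong N (\prod_(i < n) f i)%g (f k * \prod_(i < n) g i)%g.
Proof.
elim: n f g k => [|n IHn] f g k Sf Nfg gk fg; first by case: k {Nfg gk fg}.
rewrite !big_ord_recl; case: (unliftP ord0 k) => [k'|] kE; last first.
  rewrite kE in gk fg *; rewrite gk mul1g.
  rewrite (eq_bigr (fun i => g (lift ord0 i))) => [|i _]; last by rewrite fg.
  exact: cong_refl.
have [Nf0 Ng0] : N (f ord0) /\ N (g ord0) by apply: Nfg; rewrite kE.
apply: (@cong_trans (\prod_(i < n) f (lift ord0 i))%g).
  rewrite -[X in cong N _ X]mul1g.
  by apply: cong_mul => //; [apply: cong1|apply: cong_refl].
apply: (@cong_trans (f k * \prod_(i < n) g (lift ord0 i))%g).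
  rewrite kE; apply: (IHn (fun i => f (lift ord0 i)) (fun i => g (lift ord0 i))).
  - by move=> i; apply: Sf.
  - by move=> i ik; apply: Nfg; rewrite kE.
  - by rewrite -kE.
  - by move=> i ik; apply: fg; rewrite kE.
apply: cong_mul => //; first exact: cong_refl.
rewrite -[X in cong N X _]mul1g; apply: cong_mul; last exact: cong_refl.
  exact: nsub1 S_group.
exact/cong_sym/cong1.
Qed.

End NormalSub.

Section Products.
Context {gT : groupType}.

(** The indices below [c] come first in the product, so nothing has to commute. *)
Lemma prod_split n c (f : nat -> gT) :
  (\prod_(j < n) f j = (\prod_(j < n) if (j < c)%N then f j else 1) *
    (\prod_(j < n) if (j < c)%N then 1 else f j))%g.
Proof.
elim: n => [|n IHn]; first by rewrite !big_ord0 mulg1.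
rewrite !big_ord_recr /= IHn; case: ltnP => nc; last by rewrite mulg1 mulgA.
rewrite [X in (_ = _ * (X * _))%g]big1 => [|i _]; last first.
  by rewrite (ltn_trans (ltn_ord i) nc).
rewrite [X in ((_ * X) * _)%g]big1 => [|i _]; last first.
  by rewrite (ltn_trans (ltn_ord i) nc).
by rewrite !mulg1.
Qed.

Lemma prod_single n c (x : gT) :
  (\prod_(j < n) (if j == c :> nat then x else 1) = if (c < n)%N then x else 1)%g.
Proof.
elim: n => [|n IHn]; first by rewrite big_ord0.
rewrite big_ord_recr /= IHn ltnS.
by case: (ltngtP n c) => ?; rewrite ?mulg1 ?mul1g.
Qed.

End Products.

(** * Factorizations of [alpha] by start time *)

Section Alpha.
Context {A : int -> finGroupType} {l : nat}.
Implicit Types r : genfam A l.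

Lemma gseq_mulE (a b : gseq A) (i : int) : (a * b)%g i = (a i * b i)%g.
Proof. by []. Qed.

Lemma gseq_prodE (n : nat) (f : 'I_n -> gseq A) (i : int) :
  (\prod_(j < n) f j)%g i = (\prod_(j < n) f j i)%g.
Proof. exact: (big_morph (fun a : gseq A => a i)). Qed.

(** The support condition of basis families, isolated so that [alpha] can be factored without
    reference to a basis. *)
Definition spanned r : Prop := forall (s : int) (m : 'I_l.+1) (i : int),
  ~~ (s <= i <= s + m%:Z) -> r s m i = 1%g.

Definition cut (P : pred int) r : genfam A l :=
  fun s m => if P s then r s m else 1%g.

Definition layer r (s : int) : gseq A := (\prod_(m < l.+1) r s m)%g.

Definition window r (t : int) (n : nat) : gseq A :=
  (\prod_(j < n) layer r (t - j%:Z))%g.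

Lemma cut_spanned P r : spanned r -> spanned (cut P r).
Proof. by move=> sr s m i si; rewrite /cut; case: (P s) => //; apply: sr. Qed.

Lemma layer_cut P r s : layer (cut P r) s = if P s then layer r s else 1%g.
Proof. by rewrite /layer /cut; case: (P s) => //; rewrite big1. Qed.

Lemma layer_out r s i : spanned r -> ~~ (s <= i <= s + l%:Z) -> layer r s i = 1%g.
Proof.
by move=> sr si; rewrite /layer gseq_prodE big1 // => m _; apply: sr; have := ltn_ord m; lia.
Qed.

Lemma alphaE r i : spanned r ->
  alpha r i = (\prod_(j < l.+1) layer r (i - j%:Z) i)%g.
Proof.
move=> sr; apply: eq_bigr => j _; rewrite /layer gseq_prodE big_mkcond /=.
by apply: eq_bigr => k _; case: leqP => // kj; rewrite sr //; lia.
Qed.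

Lemma alpha_out r (i : int) : spanned r ->
  (forall s m, s <= i <= s + l%:Z -> r s m = 1%g) -> alpha r i = 1%g.
Proof.
move=> sr r1; rewrite alphaE // big1 // => j _.
by rewrite /layer big1 // => m _; apply: r1; have := ltn_ord j; lia.
Qed.

(** At time [i] the start times [i - j] decrease along the product, so those above [c] form the
    initial segment [j < i - c]. *)
Lemma alpha_cut r (c : int) : spanned r ->
  alpha r = (alpha (cut (fun s => c < s) r) * alpha (cut (fun s => s <= c) r))%g.
Proof.
move=> sr; apply: functional_extensionality_dep => i.
rewrite gseq_mulE !alphaE //; try exact: cut_spanned.
case: (ltP c i) => ci; last first.
  rewrite [X in (_ = X * _)%g]big1 ?mul1g => [|j _]; last first.
    by rewrite layer_cut ifF //; lia.
  by apply: eq_bigr => j _; rewrite layer_cut ifT //; lia.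
rewrite (prod_split _ `|i - c|%N (fun j => layer r (i - j%:Z) i)).
congr (_ * _)%g; apply: eq_bigr => j _; rewrite layer_cut.
  by rewrite (_ : (c < i - j%:Z) = (j < `|i - c|)%N); [case: ifP|lia].
by rewrite (_ : (i - j%:Z <= c) = ~~ (j < `|i - c|)%N); [case: ifP|lia].
Qed.

Lemma alpha_layer r (c : int) : spanned r -> alpha (cut (pred1 c) r) = layer r c.
Proof.
move=> sr; apply: functional_extensionality_dep => i.
rewrite alphaE; last exact: cut_spanned.
case: (boolP (c <= i <= c + l%:Z)) => ci; last first.
  rewrite layer_out // big1 // => j _; rewrite layer_cut /=.
  by case: eqP => // jc; rewrite layer_out //; have := ltn_ord j; lia.
rewrite (eq_bigr (fun j : 'I_l.+1 =>
    if j == `|i - c|%N :> nat then layer r c i else 1%g)) => [|j _].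
  by rewrite prod_single ifT //; lia.
rewrite layer_cut /= (_ : (i - j%:Z == c) = (j == `|i - c|%N :> nat)); last lia.
by case: eqP => // jc; congr (layer r _ i); lia.
Qed.

Lemma window_eq r r' t n :
  (forall s m, t - n%:Z < s <= t -> r s m = r' s m) -> window r t n = window r' t n.
Proof.
move=> rr'; apply: eq_bigr => j _; apply: eq_bigr => m _; apply: rr'.
by have := ltn_ord j; lia.
Qed.

Lemma alpha_window r (t : int) (n : nat) : spanned r ->
  (forall s m, ~~ (t - n%:Z < s <= t) -> r s m = 1%g) -> alpha r = window r t n.
Proof.
elim: n r => [|n IHn] r sr r1.
  rewrite /window big_ord0; apply: functional_extensionality_dep => i.
  by apply: alpha_out => // s m _; apply: r1; lia.
rewrite (@alpha_cut _ (t - n%:Z)) // /window big_ord_recr /=; congr (_ * _)%g.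
  rewrite IHn; last 2 first.
  - exact: cut_spanned.
  - by move=> s m st; rewrite /cut; case: ifP => // ?; apply: r1; lia.
  by apply: window_eq => s m st; rewrite /cut ifT //; lia.
rewrite -alpha_layer //; congr (alpha _).
apply: functional_extensionality_dep => s; apply: functional_extensionality_dep => m.
rewrite /cut /=; case: ifP => sn; case: ifP => // sn'; try lia.
by apply: r1; lia.
Qed.

(** With [n = l.+1] the outer factors are trivial modulo N(t,k), which leaves a finite product to
    compare. *)
Lemma alpha_factor r (t : int) (n : nat) : spanned r ->
  alpha r = (alpha (cut (fun s => (t < s)%R) r) *
    (window r t n * alpha (cut (fun s => (s <= t - n%:Z)%R) r)))%g.
Proof.
move=> sr; rewrite {1}(@alpha_cut r t) //; congr (_ * _)%g.
rewrite (@alpha_cut _ (t - n%:Z)); last exact: cut_spanned.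
congr (_ * _)%g.
  rewrite (@alpha_window _ t n); last 2 first.
  - by do 2 apply: cut_spanned.
  - by move=> s m st; rewrite /cut; case: ifP => // ?; case: ifP => // ?; lia.
  by apply: window_eq => s m st; rewrite /cut !ifT //; lia.
congr (alpha _); apply: functional_extensionality_dep => s.
apply: functional_extensionality_dep => m.
by rewrite /cut; case: ifP => // ?; rewrite ifT //; lia.
Qed.

End Alpha.

(** * The normal subgroups N(t,k) of the group system *)

Section System.
Context {A : int -> finGroupType} {S : set (gseq A)} {l : nat}.
Hypothesis S_system : group_system S.
Hypothesis S_controllable : controllable S l.
Hypothesis S_complete : complete_system S.
Context {B : int -> 'I_l.+1 -> set (gseq A)}.
Hypothesis B_basis : is_basis S B.
Implicit Types (r : genfam A l) (t : int) (k : nat).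

Lemma system_normal : normal_sub S S.
Proof.
have [[]] := S_system; rewrite inE => S1 Sdiv _.
have SV x : S x -> S x^-1%g.
  by move=> Sx; have := Sdiv 1%g x; rewrite !inE mul1g; apply.
have SM x y : S x -> S y -> S (x * y)%g.
  by move=> Sx /SV Sy; have := Sdiv x y^-1%g; rewrite !inE invgK; apply.
by split=> // x s Sx Ss; apply: (SM) => //; [apply: SM|apply: SV].
Qed.

Let S1 : S 1%g := nsub1 system_normal.

Let SM x y : S x -> S y -> S (x * y)%g.
Proof. exact: (nsubM system_normal). Qed.

Let SV x : S x -> S x^-1%g.
Proof. exact: (nsubV system_normal). Qed.

Lemma one_outside_normal (P : int -> Prop) :
  normal_sub S [set a | S a /\ forall i, P i -> a i = 1%g].
Proof.
split=> [x []|||x []|x s [Sx x1] Ss] //.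
- by move=> x y [Sx x1] [Sy y1]; split=> [|i Pi]; [apply: SM|rewrite gseq_mulE x1 ?y1 ?mulg1].
- by move=> Sx x1; split=> [|i Pi]; [apply: SV|rewrite -[LHS]/(x i)^-1%g x1 ?invg1].
- split=> [|i Pi]; first by apply: SM; [apply: SM|apply: SV].
  rewrite !gseq_mulE -[X in (_ * X)%g]/(s i)^-1%g x1 // mulg1; exact: mulgV.
Qed.

(** This is N(t,k); [k] is an unbounded natural number so that k = l + 1 is available. *)
Definition Nsub t k : set (gseq A) := prodset (Xsub S (t + 1)) (Ysub S (t + k%:Z - 1)).

Lemma Nsub_normal t k : normal_sub S (Nsub t k).
Proof. by apply: normal_prodset; [apply: system_normal|..]; apply: one_outside_normal. Qed.

Let NN := Nsub_normal.

Lemma NsubX t k a : S a -> (forall i, i <= t -> a i = 1%g) -> Nsub t k a.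
Proof.
move=> Sa a1; exists a; first by split=> // i it; apply: a1; lia.
by exists 1%g; rewrite ?mulg1 //; split.
Qed.

Lemma NsubY t k a : S a -> (forall i, t + k%:Z <= i -> a i = 1%g) -> Nsub t k a.
Proof.
move=> Sa a1; exists 1%g; first by split.
by exists a; rewrite ?mul1g //; split=> // i it; apply: a1; lia.
Qed.

Lemma Nsub_cong t k a b : Nsub t k a -> Nsub t k b -> cong (Nsub t k) a b.
Proof.
move=> Na /(nsubV (NN t k)) Nb; exact: (nsubM (NN t k) Na Nb).
Qed.

(** Controllability joins 1 before [t + 1] to [a] from [t + 1 + l] on; the joining sequence [b] lies
    in X^{t+1} and [b^-1 * a] in Y^{t+l}. *)
Lemma Nsub_top t a : S a -> Nsub t l.+1 a.
Proof.
move=> Sa; have [b [Sb b1 ba]] := S_controllable (t + 1) S1 Sa.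
exists b; first by split.
exists (b^-1 * a)%g; last by rewrite mulVKg.
split=> [|i it]; first by apply: SM => //; apply: SV.
rewrite gseq_mulE -[X in (X * _)%g]/(b i)^-1%g ba ?mulVg //; lia.
Qed.

Lemma Rset_supp r (s : int) (m : 'I_l.+1) (i : int) : Rset B r -> ~~ (s <= i <= s + m%:Z) -> r s m i = 1%g.
Proof. by move=> /(_ s m) Br; have [_ /(_ _ Br)[_ r1] _] := B_basis s m; apply: r1. Qed.

Lemma Rset_spanned r : Rset B r -> spanned r.
Proof. by move=> Rr s m i; apply: Rset_supp. Qed.

Lemma Rset_S r (s : int) (m : 'I_l.+1) : Rset B r -> S (r s m).
Proof. by move=> /(_ s m) Br; have [_ /(_ _ Br)[]] := B_basis s m. Qed.

Lemma Rset_cut (P : pred int) r : Rset B r -> Rset B (cut P r).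
Proof.
by move=> Rr s m; rewrite /cut; case: ifP => // _; have [] := B_basis s m.
Qed.

Lemma layer_S r s : Rset B r -> S (layer r s).
Proof. by move=> Rr; rewrite /layer; apply: (prod_mem system_normal) => m; apply: Rset_S. Qed.

Lemma window_S r t n : Rset B r -> S (window r t n).
Proof. by move=> Rr; rewrite /window; apply: (prod_mem system_normal) => m; apply: layer_S. Qed.

Lemma alpha_S r : Rset B r -> S (alpha r).
Proof.
move=> Rr; apply: S_complete => m n.
(* On [m,n] this window agrees with [alpha r]: later layers have not begun, and earlier ones,
   started at [m - l - 1] or before, are over. *)
exists (window r n (`|n - m| + l.+1)%N); first exact: window_S.
move=> i mn; rewrite (@alpha_factor _ _ r n (`|n - m| + l.+1)%N); last exact: Rset_spanned.
rewrite !gseq_mulE !alpha_out ?mul1g ?mulg1 //.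
- by apply/Rset_spanned/Rset_cut.
- by move=> s k si; rewrite /cut ifF //; lia.
- by apply/Rset_spanned/Rset_cut.
- by move=> s k si; rewrite /cut ifF //; lia.
Qed.

(** * The class of [alpha r] modulo N(t,k) and the triangle T_k^t *)

Lemma alpha_cut_right_N r t k :
  Rset B r -> Nsub t k (alpha (cut (fun s => (t < s)%R) r)).
Proof.
move=> Rr; apply: NsubX => [|i it]; first by apply/alpha_S/Rset_cut.
apply: alpha_out => [|s m si]; first by apply/Rset_spanned/Rset_cut.
by rewrite /cut ifF //; lia.
Qed.

Lemma alpha_cut_left_N r t k :
  Rset B r -> Nsub t k (alpha (cut (fun s => (s <= t - l.+1%:Z)%R) r)).
Proof.
move=> Rr; apply: NsubY => [|i it]; first by apply/alpha_S/Rset_cut.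
apply: alpha_out => [|s m si]; first by apply/Rset_spanned/Rset_cut.
by rewrite /cut ifF //; lia.
Qed.

(* Spans [s,s+m] containing [t,t+k]; k is allowed to exceed l, where the
   condition is empty. *)
Definition agree t k r r' : Prop := forall (s : int) (m : 'I_l.+1),
  s <= t -> t + k%:Z <= s + m%:Z -> r s m = r' s m.

Lemma gen_N r t k s (m : 'I_l.+1) :
  Rset B r -> s + m%:Z < t + k%:Z -> Nsub t k (r s m).
Proof.
move=> Rr st; apply: NsubY => [|i it]; first exact: Rset_S.
by apply: Rset_supp => //; lia.
Qed.

(** Factor by factor, two corresponding generators of the window either coincide by [agree] or both
    lie in N(t,k). *)
Lemma alpha_cong r r' t k : Rset B r -> Rset B r' -> agree t k r r' ->
  cong (Nsub t k) (alpha r) (alpha r').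
Proof.
move=> Rr Rr' rr'; have [sr sr'] := (Rset_spanned Rr, Rset_spanned Rr').
rewrite (@alpha_factor _ _ r t l.+1) // (@alpha_factor _ _ r' t l.+1) //.
apply: (cong_mul (NN t k)); first by apply/alpha_S/Rset_cut.
  by apply: Nsub_cong; apply: alpha_cut_right_N.
apply: (cong_mul (NN t k)); first exact: window_S.
  rewrite /window; apply: (prod_cong system_normal (NN t k)) => j; first exact: layer_S.
  rewrite /layer; apply: (prod_cong system_normal (NN t k)) => m; first exact: Rset_S.
  case: (lerP (t + k%:Z) (t - j%:Z + m%:Z)) => tm.
    by rewrite rr' //; [apply: cong_refl|lia].
  by apply: Nsub_cong; apply: gen_N.
by apply: Nsub_cong; apply: alpha_cut_left_N.
Qed.

(** Deletes the lower vertex of T_k^t; the rest of that triangle is the union of T_{k+1}^t and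
    T_{k+1}^{t-1}. *)
Definition erase t (k : 'I_l.+1) r : genfam A l :=
  fun s m => if (s == t) && (m == k) then 1%g else r s m.

Lemma Rset_erase t (k : 'I_l.+1) r : Rset B r -> Rset B (erase t k r).
Proof.
by move=> Rr s m; rewrite /erase; case: ifP => // _; have [] := B_basis s m.
Qed.

(** To the left of [r t k] stand only generators starting after [t] and those of layer [t] with
    index below [k], all in N(t,k). *)
Lemma alpha_pivot r t (k : 'I_l.+1) : Rset B r ->
  cong (Nsub t k) (alpha r) (r t k * alpha (erase t k r))%g.
Proof.
move=> Rr; have Re := Rset_erase t k Rr; set e := erase t k r.
have [sr se] := (Rset_spanned Rr, Rset_spanned Re).
rewrite (@alpha_factor _ _ r t l.+1) // (@alpha_factor _ _ e t l.+1) //.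
have -> : window r t l.+1 = (layer r t * window r (t - 1) l)%g.
  rewrite /window big_ord_recl /= subr0; congr (_ * _)%g.
  by apply: eq_bigr => j _; congr (layer r _); rewrite /bump /=; lia.
have -> : window e t l.+1 = (layer e t * window r (t - 1) l)%g.
  rewrite /window big_ord_recl /= subr0; congr (_ * _)%g.
  apply: eq_bigr => j _; apply: eq_bigr => m _.
  rewrite /e /erase (_ : _ == t = false) ?andFb; last by rewrite /bump /=; lia.
  by congr (r _ m); rewrite /bump /=; lia.
set x := alpha (cut _ r); set x' := alpha (cut _ e).
set y := alpha (cut _ r); set y' := alpha (cut _ e).
set R := window _ _ _.
have Sx : S x by apply/alpha_S/Rset_cut.
have SR : S R by apply: window_S.
have Nx : Nsub t k x by apply: alpha_cut_right_N.
have Nx' : Nsub t k x' by apply: alpha_cut_right_N.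
have Ny : Nsub t k y by apply: alpha_cut_left_N.
have Ny' : Nsub t k y' by apply: alpha_cut_left_N.
(* The intermediate product drops [x], brings [r t k] to the front and replaces [y] by [y']; then
   [x'], also in N(t,k), is inserted. *)
apply: (@cong_trans _ _ _ (NN t k) (1 * ((r t k * layer e t) * R * y'))%g).
  apply: (cong_mul (NN t k)) => //; first exact: cong1.
  apply: (cong_mul (NN t k)); first by apply: SM => //; apply: layer_S.
    apply: (cong_mul (NN t k)); first exact: layer_S.
      rewrite /layer; apply: (prod_cong_pivot system_normal (NN t k)) => [m|m mk||m km].
      - exact: Rset_S.
      - by split; apply: gen_N => //; lia.
      - by rewrite /e /erase !eqxx.
      - by rewrite /e /erase (_ : m == k = false) ?andbF //; apply/eqP => E; move: km; rewrite E ltnn.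
    exact: cong_refl.
  exact: Nsub_cong.
apply: (cong_sym (NN t k)).
rewrite mul1g -!mulgA; apply: (cong_mul (NN t k)); first exact: Rset_S.
  exact: cong_refl.
rewrite -[X in cong _ _ X]mul1g; apply: (cong_mul (NN t k)).
- by apply/alpha_S/Rset_cut.
- exact: cong1.
- exact: cong_refl.
Qed.

(** By the modular law, N(t,k) meets X^t in the denominator of [Lambda], so congruent elements of
    the transversal share a coset. *)
Lemma basis_inj t (k : 'I_l.+1) g h :
  B t k g -> B t k h -> cong (Nsub t k) g h -> g = h.
Proof.
move=> Bg Bh gh; have [[_ tr] Bsub _] := B_basis t k.
have [Sg g1] := Bsub _ Bg; have [Sh h1] := Bsub _ Bh.
have Lg : Lambda S t k [set (g * d)%g | d in shell S t (t + k%:Z - 1)].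
  exists g => //; exists 1%g; first by split.
  exists g; last by rewrite mul1g.
  by split; split=> // i it; apply: g1; lia.
have [b [_ bU]] := tr _ Lg.
rewrite -(bU g); first rewrite -(bU h) //.
- split=> //; exists (g^-1 * h)%g; last by rewrite mulVKg.
  (* [Lambda] consists of left cosets, so [h * g^-1] is conjugated into [g^-1 * h]. *)
  have : Nsub t k (g^-1 * (h * g^-1) * g^-1^-1)%g.
    by apply: (nsubJ (NN t k)); [apply: (cong_sym (NN t k))|apply: SV].
  rewrite invgK !mulgA mulgKV => -[x Xx [y Yy xy]].
  exists x => //; exists y => //; split=> //; have [Sx x1] := Xx; have [Sy y1] := Yy.
  split=> // i it; have -> : y = (x^-1 * (g^-1 * h))%g by rewrite -xy mulKg.
  rewrite !gseq_mulE -[X in (X * _)%g]/(x i)^-1%g -[X in (_ * (X * _))%g]/(g i)^-1%g.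
  by rewrite x1 ?g1 ?h1 ?invg1 ?mulg1 //; lia.
- split=> //; exists 1%g; last by rewrite mulg1.
  by exists 1%g; [split|exists 1%g; [split; split|rewrite mulg1]].
Qed.

Lemma basis_cover t (k : 'I_l.+1) h : S h ->
  (forall i, ~~ (t <= i <= t + k%:Z) -> h i = 1%g) ->
  exists2 g, B t k g & cong (Nsub t k) g h.
Proof.
move=> Sh h1; have [[_ tr] Bsub _] := B_basis t k.
have Lh : Lambda S t k [set (h * d)%g | d in shell S t (t + k%:Z - 1)].
  exists h => //; exists 1%g; first by split.
  exists h; last by rewrite mul1g.
  by split; split=> // i it; apply: h1; lia.
have [g [[Bg [d [x Xx [y [_ Yy] <-]] gE]] _]] := tr _ Lh.
exists g => //; rewrite -gE.
by apply: (nsubJ (NN t k)) => //; exists x => //; exists y.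
Qed.

(** From the two decompositions c = x y = x' y' take h = y y'^-1 = x^-1 x': the first form is
    trivial after t+k, the second before t. *)
Lemma Nsub_cap t k c : Nsub t k.+1 c -> Nsub (t - 1) k.+1 c ->
  exists h, [/\ S h, forall i, ~~ (t <= i <= t + k%:Z) -> h i = 1%g & cong (Nsub t k) c h].
Proof.
move=> [x Xx [y [Sy y1] xy]] [x' [Sx' x'1] [y' Yy' xy']].
have [Sx x1] := Xx; have [Sy' y'1] := Yy'.
exists (y * y'^-1)%g; split.
- by apply: SM => //; apply: SV.
- move=> i; rewrite negb_and -!ltNge => /orP[it|it]; last first.
    rewrite gseq_mulE -[X in (_ * X)%g]/(y' i)^-1%g y1 ?y'1 ?invg1 ?mulg1 //; lia.
  have -> : (y * y'^-1 = x^-1 * x')%g.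
    by apply: (mulgI x); rewrite mulgA xy -xy' mulVKg mulgK.
  rewrite gseq_mulE -[X in (X * _)%g]/(x i)^-1%g x1 ?x'1 ?invg1 ?mulg1 //; lia.
- rewrite -xy /cong invgM invgK.
  have -> : (x * y * (y' * y^-1) = x * (y * y' * y^-1))%g by rewrite !mulgA.
  apply: (nsubM (NN t k)); first by apply: NsubX => // i it; apply: x1; lia.
  apply: (nsubJ (NN t k)) => //.
  by apply: NsubY => // i it; apply: y'1; lia.
Qed.

(** Widening the interval [t,t+k] shrinks the triangle and enlarges N(t,k). *)
Lemma Nsub_mono t k t' k' :
  t' <= t -> t + k%:Z <= t' + k'%:Z -> Nsub t k `<=` Nsub t' k'.
Proof.
move=> tt' kk' _ [x [Sx x1] [y [Sy y1] <-]]; apply: (nsubM (NN t' k')).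
  by apply: NsubX => // i it; apply: x1; lia.
by apply: NsubY => // i it; apply: y1; lia.
Qed.

Lemma agree_of_cong t k r r' : Rset B r -> Rset B r' ->
  cong (Nsub t k) (alpha r) (alpha r') -> agree t k r r'.
Proof.
(* Induction on l+1-k through an upper bound [n], with [t] free because the triangle at [t - 1] is
   needed too; for k > l no span contains [t,t+k]. *)
move=> Rr Rr'; move: {-1}(l.+1 - k)%N (leqnn (l.+1 - k)) => n.
elim: n k t => [|n IHn] k t kn rr' s m st tsm.
  by have := ltn_ord m; lia.
have kl : (k < l.+1)%N by have := ltn_ord m; lia.
have up : agree t k.+1 r r'.
  by apply: IHn; [lia|apply: (@Nsub_mono t k) rr'; lia].
have left_ : agree (t - 1) k.+1 r r'.
  by apply: IHn; [lia|apply: (@Nsub_mono t k) rr'; lia].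
pose K := Ordinal kl.
have eqE : cong (Nsub t k) (alpha (erase t K r)) (alpha (erase t K r')).
  apply: alpha_cong; try exact: Rset_erase.
  move=> s' m' s't tsm'; rewrite /erase -[m' == K]val_eqE /=; case: ifP => // sm.
  by case: (ltP s' t) => ?; [apply: left_; lia|apply: up; lia].
have [->|nst] := eqVneq s t; last by apply: left_; lia.
have [mk|nmk] := eqVneq m K; last first.
  by apply: up; [lia|move: nmk; rewrite -val_eqE /=; lia].
rewrite mk; apply: (@basis_inj t K) => //.
(* Modulo N(t,k) both products begin with their lower vertex; cancelling the congruent erased
   families leaves the two generators. *)
apply: (cong_cancel (NN t k) _ _ eqE); first exact: Rset_S.
apply: (cong_trans (NN t k)) _ (alpha_pivot t K Rr').
by apply: (cong_trans (NN t k)) _ rr'; apply: (cong_sym (NN t k)); apply: (alpha_pivot t K).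
Qed.

(** * Bijectivity of [alpha] *)

Lemma Rset1 : Rset B (fun _ _ => 1%g).
Proof. by move=> s m; have [] := B_basis s m. Qed.

(** Generators are corrected one index at a time, from [l] downwards; round [n.+1] changes index
    [l - n] only. *)
Lemma alpha_approx (a : gseq A) n : S a -> (n <= l.+1)%N -> exists2 r, Rset B r &
  forall t k, (l.+1 - n <= k <= l.+1)%N -> cong (Nsub t k) a (alpha r).
Proof.
move=> Sa; elim: n => [|n IHn] nl.
  exists (fun _ _ => 1%g); first exact: Rset1.
  move=> t k kl; have -> : k = l.+1 by lia.
  by apply: Nsub_top; apply: SM => //; apply: SV; apply: alpha_S; apply: Rset1.
have [r Rr ar] := IHn (ltnW nl).
have kl : (l - n < l.+1)%N by lia.
pose K := Ordinal kl.
(* Modulo N(t,K+1) and N(t-1,K+1) the generator at (K,t) is invisible, so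
   [a * (alpha (erase t K r))^-1] lies in both; up to N(t,K) it is then a sequence supported on
   [t,t+K], hence a basis element. *)
have /choice[g gP] : forall t, exists g, B t K g /\
    cong (Nsub t K) g (a * (alpha (erase t K r))^-1)%g.
  move=> t; have Re := Rset_erase t K Rr.
  have ae s : s <= t -> t <= s + 1 -> cong (Nsub s K.+1) a (alpha (erase t K r)).
    move=> st ts; apply: (cong_trans (NN s K.+1)) (ar s K.+1 _) _; first by rewrite /=; lia.
    apply: alpha_cong => // s' m s's sm; rewrite /erase.
    case: ifP => // /andP[/eqP s't /eqP mK]; rewrite mK in sm; lia.
  have [h [Sh h1 ch]] := Nsub_cap (ae t ltac:(lia) ltac:(lia)) (ae (t - 1) ltac:(lia) ltac:(lia)).
  have [b Bb bh] := basis_cover Sh h1.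
  exists b; split=> //; apply: (cong_trans (NN t K)) bh _.
  exact: (cong_sym (NN t K)).
(* All times are corrected at once: modulo N(t,K) the only generator of index [K] that counts is the
   one at [t]. *)
pose r' : genfam A l := fun s m => if m == K then g s else r s m.
have Rr' : Rset B r'.
  move=> s m; rewrite /r'; case: eqP => [->|_]; last exact: Rr.
  by have [] := gP s.
exists r' => // t k kn.
have [kK|kK] : k = K \/ (K < k)%N by rewrite /=; lia.
  have Re := Rset_erase t K Rr; have Re' := Rset_erase t K Rr'.
  rewrite kK; apply: (cong_sym (NN t K)).
  apply: (cong_trans (NN t K)) (alpha_pivot t K Rr') _.
  rewrite -[X in cong _ _ X](mulgKV (alpha (erase t K r)) a).
  apply: (cong_mul (NN t K)); first exact: Rset_S.
    by rewrite /r' eqxx; have [] := gP t.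
  apply: alpha_cong => // s m st tsm; rewrite /erase /r'; case: ifP => // sm.
  by case: eqP => // mK; move: sm tsm; rewrite mK eqxx andbT; lia.
apply: (cong_trans (NN t k)) (ar t k _) _; first by move: kK => /=; lia.
apply: alpha_cong => // s m st tsm; rewrite /r'.
by case: eqP => // mK; move: tsm; rewrite mK; lia.
Qed.

Lemma alpha_surj (a : gseq A) : S a -> exists2 r, Rset B r & alpha r = a.
Proof.
move=> Sa; have [r Rr ar] := alpha_approx Sa (leqnn l.+1).
exists r => //; apply: functional_extensionality_dep => t.
have [x [_ x1] [y [_ y1] xy]] := ar t 0%N ltac:(lia).
apply/esym/(mulIg (alpha r t)^-1%g); rewrite mulgV.
have -> : (a t * (alpha r t)^-1 = (x * y) t)%g by rewrite xy.
by rewrite gseq_mulE x1 ?y1 ?mulg1 //; lia.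
Qed.

(** Each generator is the lower vertex of its own triangle, so its class modulo N(t,m) recovers
    it. *)
Lemma alpha_inj r r' : Rset B r -> Rset B r' -> alpha r = alpha r' -> r = r'.
Proof.
move=> Rr Rr' rr'; apply: functional_extensionality_dep => t.
apply: functional_extensionality_dep => m.
by apply: (@agree_of_cong t m) => //; rewrite rr'; apply: cong_refl (NN t m) _.
Qed.

Lemma alpha_invP (a : gseq A) : S a -> Rset B (alpha_inv B a) /\ alpha (alpha_inv B a) = a.
Proof.
move=> /alpha_surj[r Rr <-]; rewrite /alpha_inv pinvKV ?inE //.
by move=> r1 r2; rewrite !inE; apply: alpha_inj.
Qed.

(** * The generator group and the upper elementary groups *)

Section Labels.
Context {G : int -> 'I_l.+1 -> Type} {lab : forall t (k : 'I_l.+1), gseq A -> G t k}.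
Hypothesis lab_bij : forall t (k : 'I_l.+1), set_bij (B t k) [set: G t k] (lab t k).
Implicit Types u : labfam G.

Lemma lab_inj t (k : 'I_l.+1) g h : B t k g -> B t k h -> lab t k g = lab t k h -> g = h.
Proof. by have [_ inj _] := lab_bij t k => Bg Bh; apply: inj; rewrite inE. Qed.

Lemma beta_inj r r' : Rset B r -> Rset B r' -> beta lab r = beta lab r' -> r = r'.
Proof.
move=> Rr Rr' rr'; apply: functional_extensionality_dep => t.
apply: functional_extensionality_dep => m; apply: (lab_inj (Rr t m) (Rr' t m)).
exact: (congr1 (fun u : labfam G => u t m) rr').
Qed.

Lemma betaK r : Rset B r -> beta_inv B lab (beta lab r) = r.
Proof.
by move=> Rr; rewrite /beta_inv pinvKV ?inE // => r1 r2; rewrite !inE; apply: beta_inj.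
Qed.

Lemma beta_surj u : exists2 r, Rset B r & beta lab r = u.
Proof.
have P t (k : 'I_l.+1) : exists g, B t k g /\ lab t k g = u t k.
  by have [_ _ /(_ (u t k) I)[g Bg <-]] := lab_bij t k; exists g.
exists (fun t m => projT1 (cid (P t m))) => [t k|]; first by case: cid => ? [].
apply: functional_extensionality_dep => t; apply: functional_extensionality_dep => k.
by rewrite /beta; case: cid => ? [].
Qed.

Lemma beta_invP u : Rset B (beta_inv B lab u) /\ beta lab (beta_inv B lab u) = u.
Proof. by have [r Rr <-] := beta_surj u; rewrite betaK. Qed.

(** The bijection from label families onto [S] that turns [circ] into the product of sequences. *)
Definition seq_of u : gseq A := alpha (beta_inv B lab u).

Lemma seq_of_S u : S (seq_of u).
Proof. by apply: alpha_S; case: (beta_invP u). Qed.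

Lemma seq_of_inj : injective seq_of.
Proof.
move=> u v uv; have [Ru <-] := beta_invP u; have [Rv <-] := beta_invP v.
by congr beta; apply: alpha_inj.
Qed.

Lemma seq_of_surj (a : gseq A) : S a -> exists u, seq_of u = a.
Proof.
move=> /alpha_surj[r Rr ra]; exists (beta lab r).
by rewrite /seq_of betaK.
Qed.

Lemma seq_of_circ u v : seq_of (circ B lab u v) = (seq_of u * seq_of v)%g.
Proof.
rewrite {1}/seq_of /circ /star.
have [Rr ra] := alpha_invP (SM (seq_of_S u) (seq_of_S v)).
by rewrite betaK.
Qed.

(** The fibres of [nabla t k] correspond to the cosets of N(t,k) in [S]; normality then makes the
    induced operation well defined. *)
Lemma nabla_eq_cong t (k : 'I_l.+1) u v :
  nabla t k u = nabla t k v <-> cong (Nsub t k) (seq_of u) (seq_of v).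
Proof.
have [Ru uE] := beta_invP u; have [Rv vE] := beta_invP v; split=> [uv|uv].
  apply: alpha_cong => // s m st tsm; apply: lab_inj; [exact: Ru|exact: Rv|].
  have Tms : triangle t k (m, s).
    by exists `|t - s|%N => /=; have := ltn_ord m; split; lia.
  have := congr1 (fun x : trifam G (triangle t k) => x (m, s) Tms) uv.
  by rewrite /nabla /= -{1}uE -{1}vE.
have uvs := agree_of_cong Ru Rv uv.
apply: functional_extensionality_dep => -[m s].
apply: functional_extensionality_dep => -[j [/= jl mj sE]].
rewrite /nabla /= -uE -vE /beta uvs //; lia.
Qed.

Lemma nabla_circ t (k : 'I_l.+1) u u' v v' :
  nabla t k u = nabla t k u' -> nabla t k v = nabla t k v' ->
  nabla t k (circ B lab u v) = nabla t k (circ B lab u' v').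
Proof.
move=> /nabla_eq_cong uu' /nabla_eq_cong vv'; apply/nabla_eq_cong.
by rewrite !seq_of_circ; apply: (cong_mul (NN t k)) => //; apply: seq_of_S.
Qed.

(** The default only supplies an inhabitant; the lift matters on the image of [nabla]. *)
Definition lift_nabla t (k : 'I_l.+1) (x : trifam G (triangle t k)) : labfam G :=
  'pinv_(fun=> beta lab (fun _ _ => 1%g)) setT (nabla t k) x.

Lemma lift_nablaK t (k : 'I_l.+1) u : nabla t k (lift_nabla (nabla t k u)) = nabla t k u.
Proof. by apply: pinvK; rewrite inE; exists u. Qed.

Definition tri_op t (k : 'I_l.+1) (x y : trifam G (triangle t k)) :
    trifam G (triangle t k) :=
  nabla t k (circ B lab (lift_nabla x) (lift_nabla y)).

Lemma tri_opE t (k : 'I_l.+1) u v :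
  tri_op (nabla t k u) (nabla t k v) = nabla t k (circ B lab u v).
Proof. by apply: nabla_circ; apply: lift_nablaK. Qed.

(** Since [seq_of] is injective and multiplicative with image [S], the group axioms hold for [circ],
    and [nabla] carries them over. *)
Lemma tri_op_group t (k : 'I_l.+1) : upper_elementary_group (circ B lab) (@tri_op t k).
Proof.
split; first exact: tri_opE.
have [e eE] := seq_of_surj S1; split.
- by move=> _ _ [u _ <-] [v _ <-]; rewrite tri_opE; eexists.
- move=> _ _ _ [u _ <-] [v _ <-] [w _ <-]; rewrite !tri_opE; congr nabla.
  by apply: seq_of_inj; rewrite !seq_of_circ mulgA.
- exists (nabla t k e); first by exists e.
  split=> _ [u _ <-].
    rewrite !tri_opE; split; congr nabla; apply: seq_of_inj;
      by rewrite seq_of_circ eE ?mul1g ?mulg1.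
  have [v vE] := seq_of_surj (SV (seq_of_S u)).
  exists (nabla t k v); first by exists v.
  rewrite !tri_opE; split; congr nabla; apply: seq_of_inj;
    by rewrite seq_of_circ vE eE ?mulVg ?mulgV.
Qed.

End Labels.
End System.

Theorem theorem44 (A : int -> finGroupType) (S : set (gseq A)) (l : nat)
  (l_gt0 : (0 < l)%N)
  (S_system : group_system S)
  (S_controllable : controllable S l)
  (S_complete : complete_system S)
  (B : int -> 'I_l.+1 -> set (gseq A))
  (B_basis : is_basis S B)
  (G : int -> 'I_l.+1 -> Type)
  (lab : forall (t : int) (k : 'I_l.+1), gseq A -> G t k)
  (lab_bij : forall (t : int) (k : 'I_l.+1), set_bij (B t k) [set: G t k] (lab t k)) :
  exists op : forall (t : int) (k : 'I_l.+1),
      trifam G (triangle t k) -> trifam G (triangle t k) -> trifam G (triangle t k),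
    (forall (t : int) (k : 'I_l.+1),
       upper_elementary_group (circ B lab) (op t k)) /\
    (forall (t t' : int) (k k' : 'I_l.+1) (sT : triangle t' k' `<=` triangle t k),
       (forall u : labfam G, tri_proj sT (nabla t k u) = nabla t' k' u) /\
       (forall x y : trifam G (triangle t k), nablaU G t k x -> nablaU G t k y ->
          tri_proj sT (op t k x y) = op t' k' (tri_proj sT x) (tri_proj sT y))).
Proof.
exists (@tri_op A l B G lab); split=> [t k|t t' k k' sT].
  exact: (tri_op_group S_system S_controllable S_complete B_basis lab_bij).
split=> [//|_ _ [u _ <-] [v _ <-]].
(* Both sides become [nabla t' k' (circ B lab u v)], because projecting [nabla t k] gives
   [nabla t' k'] by conversion. *)
have opE := tri_opE S_system S_controllable S_complete B_basis lab_bij.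
by rewrite opE (opE t' k').
Qed.
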